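(* (a) Let $\Lambda$ be a $1$-graph and let $\{t_\lambda:\lambda\in\Lambda\}$ be a collection of partial isometries in a $C^*$-algebra. Then $\{t_\lambda\}$ is a Cuntz-Krieger $\Lambda$-family if and only if it is a graph Cuntz-Krieger family (in the sense of Fowler-Laca-Raeburn, defined in the context). (b) Let $(\Lambda,d)$ be a locally convex row-finite $k$-graph and let $\{t_\lambda:\lambda\in\Lambda\}$ be a collection of partial isometries in a $C^*$-algebra. Then $\{t_\lambda\}$ is a Cuntz-Krieger $\Lambda$-family if and only if it is a row-finite Cuntz-Krieger family (in the sense of Raeburn-Sims-Yeend, defined in the context).
   Context: Conventions: $0\in\mathbb{N}$; $\mathbb{N}^k$ is a semigroup with generators $e_1,\dots,e_k$, coordinatewise partial order $\le$, and $m\vee n$ denotes the coordinatewise maximum. A $k$-graph $(\Lambda,d)$ is a countable small category $\Lambda$ with a functor $d:\Lambda\to\mathbb{N}^k$ satisfying the factorisation property: if $d(\lambda)=m+n$ there are unique $\mu,\sigma\in\Lambda$ with $d(\mu)=m$, $d(\sigma)=n$, $\lambda=\mu\sigma$. Morphisms are called paths, objects vertices; $s$ and $r$ are the domain and codomain maps, so $\lambda\mu$ is defined when $s(\lambda)=r(\mu)$. $\Lambda^n:=\{\lambda:d(\lambda)=n\}$, and objects are identified with $\Lambda^0$. For $v\in\Lambda^0$, $v\Lambda:=\{\lambda\in\Lambda:r(\lambda)=v\}$, and $vF:=v\Lambda\cap F$ for $F\subset\Lambda$. For $n\in\mathbb{N}^k$, $\Lambda^{\le n}:=\{\lambda\in\Lambda:d(\lambda)\le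 n,\text{ and }d(\lambda)_i<n_i\implies s(\lambda)\Lambda^{e_i}=\emptyset\}$. For $\lambda,\mu\in\Lambda$, $\Lambda^{\min}(\lambda,\mu):=\{(\alpha,\beta):\lambda\alpha=\mu\beta,\ d(\lambda\alpha)=d(\lambda)\vee d(\mu)\}$. $\Lambda$ is finitely aligned if every $\Lambda^{\min}(\lambda,\mu)$ is finite; $1$-graphs and row-finite $k$-graphs are finitely aligned. A set $E\subset v\Lambda$ is exhaustive if for every $\mu\in v\Lambda$ there is $\lambda\in E$ with $\Lambda^{\min}(\lambda,\mu)\ne\emptyset$. A Cuntz-Krieger $\Lambda$-family ($\Lambda$ finitely aligned) is a collection $\{t_\lambda:\lambda\in\Lambda\}$ of partial isometries in a $C^*$-algebra such that (i) $\{t_v:v\in\Lambda^0\}$ are mutually orthogonal projections; (ii) $t_\lambda t_\mu=t_{\lambda\mu}$ whenever $s(\lambda)=r(\mu)$; (iii) $t_\lambda^*t_\mu=\sum_{(\alpha,\beta)\in\Lambda^{\min}(\lambda,\mu)}t_\alpha t_\beta^*$ for all $\lambda,\mu\in\Lambda$; (iv) $\prod_{\lambda\in E}(t_v-t_\lambda t_\lambda^* )=0$ for all $v\in\Lambda^0$ and all finite exhaustive $E\subset v\Lambda$. $(\Lambda,d)$ is row-finite if $v\Lambda^{e_i}$ is finite for all $v\in\Lambda^0$ and $1\le i\le k$. It is locally convex if whenever $i\ne j$, $\lambda\in v\Lambda^{e_i}$ and $v\Lambda^{e_j}\ne\emptyset$, then $s(\lambda)\Lambda^{e_j}\neq\emptyset$.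 Graph Cuntz-Krieger family ($\Lambda$ a $1$-graph, with edge set $\Lambda^1$): $\{t_v:v\in\Lambda^0\}$ are mutually orthogonal projections; $t_\lambda t_\mu=t_{\lambda\mu}$ whenever $s(\lambda)=r(\mu)$; $t_e^*t_e=t_{s(e)}$ for all $e\in\Lambda^1$; the range projections $t_et_e^*$, $e\in\Lambda^1$, are mutually orthogonal and satisfy $t_et_e^*\le t_{r(e)}$; and $t_v=\sum_{e\in v\Lambda^1}t_et_e^*$ whenever $0<|v\Lambda^1|<\infty$. Row-finite Cuntz-Krieger family ($\Lambda$ a locally convex row-finite $k$-graph): $\{t_v:v\in\Lambda^0\}$ are mutually orthogonal projections; $t_\lambda t_\mu=t_{\lambda\mu}$ whenever $s(\lambda)=r(\mu)$; $t_\lambda^*t_\lambda=t_{s(\lambda)}$ for all $\lambda\in\Lambda$; and $t_v=\sum_{\lambda\in v\Lambda^{\le n}}t_\lambda t_\lambda^*$ for all $v\in\Lambda^0$ and $n\in\mathbb{N}^k$. *)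

(* Defs.v *)
From HB Require Import structures.
From mathcomp Require Import all_boot all_order all_algebra finmap.
From mathcomp Require Import boolp classical_sets cardinality fsbigop reals.
From mathcomp Require Import topology normedtype.
From mathcomp Require Import complex.

Set Implicit Arguments.
Unset Strict Implicit.
Unset Printing Implicit Defensive.

Import Order.TTheory GRing.Theory Num.Theory.

Local Open Scope classical_set_scope.
Local Open Scope ring_scope.
Local Open Scope complex_scope.

(* C*-algebras are not assumed to have a unit, so MathComp's (unital) algebra
   structures do not apply and the product is part of the mixin. The norm of a
   normed module over R[i] takes its values in R[i] (it is real and >= 0). *)
HB.mixin Record isCStarAlgebra (R : realType) (A : Type)
    of CompleteNormedModule R[i] A := {
  cmul : A -> A -> A;
  star : A -> A;
  cmulA : associative cmul;
  cmulDl : left_distributive cmul +%R;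
  cmulDr : right_distributive cmul +%R;
  cscaleAl : forall (c : R[i]) (x y : A), c *: cmul x y = cmul (c *: x) y;
  cscaleAr : forall (c : R[i]) (x y : A), c *: cmul x y = cmul x (c *: y);
  starK : involutive star;
  starD : {morph star : x y / x + y};
  starZ : forall (c : R[i]) (x : A), star (c *: x) = Num.conj c *: star x;
  starM : forall x y : A, star (cmul x y) = cmul (star y) (star x);
  cnormM : forall x y : A, `|cmul x y| <= `|x| * `|y|;
  cnorm_star : forall x : A, `|cmul (star x) x| = `|x| ^+ 2
}.

#[short(type="cstarAlgType")]
HB.structure Definition CStarAlgebra (R : realType) :=
  {A of isCStarAlgebra R A & CompleteNormedModule R[i] A}.

Declare Scope cstar_scope.
Delimit Scope cstar_scope with CS.
Infix "**" := cmul (at level 40, left associativity) : cstar_scope.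
Local Open Scope cstar_scope.

Section CStar.
Variables (R : realType) (A : cstarAlgType R).
Implicit Types x y p : A.

Definition projection p : Prop := p ** p = p /\ star p = p.

Definition partial_isometry x : Prop := x ** star x ** x = x.

Definition cpositive x : Prop := exists y, x = star y ** y.

Definition cle x y : Prop := cpositive (y - x).

Definition orthogonal_projections (I : Type) (p : I -> A) : Prop :=
  (forall i, projection (p i)) /\ (forall i j, i <> j -> p i ** p j = 0).

End CStar.

Section Degrees.
Variable k : nat.
Implicit Types m n : {ffun 'I_k -> nat}.

Definition degree_le m n : Prop := forall i, (m i <= n i)%N.

Definition degree_join m n : {ffun 'I_k -> nat} := [ffun i => maxn (m i) (n i)].

Definition generator (i : 'I_k) : {ffun 'I_k -> nat} :=
  [ffun j => nat_of_bool (j == i)].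

End Degrees.

(* The composition is a total function: [kcomp l m] is the composite path when
   src l = rng m, and is unspecified otherwise. The vertex v is identified with
   the path [idp v] of degree 0. *)
Record kgraph (k : nat) := KGraph {
  vertex : countType;
  kpath :> countType;
  src : kpath -> vertex;
  rng : kpath -> vertex;
  idp : vertex -> kpath;
  kcomp : kpath -> kpath -> kpath;
  deg : kpath -> {ffun 'I_k -> nat};
  src_idp : forall v, src (idp v) = v;
  rng_idp : forall v, rng (idp v) = v;
  src_comp : forall l m, src l = rng m -> src (kcomp l m) = src m;
  rng_comp : forall l m, src l = rng m -> rng (kcomp l m) = rng l;
  comp_idl : forall l, kcomp (idp (rng l)) l = l;
  comp_idr : forall l, kcomp l (idp (src l)) = l;
  compA : forall l m n, src l = rng m -> src m = rng n ->
    kcomp l (kcomp m n) = kcomp (kcomp l m) n;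
  deg_idp : forall v, deg (idp v) = 0;
  deg_comp : forall l m, src l = rng m -> deg (kcomp l m) = deg l + deg m;
  factorisation : forall l m n, deg l = m + n ->
    exists! p : kpath * kpath,
      [/\ deg p.1 = m, deg p.2 = n, src p.1 = rng p.2 & l = kcomp p.1 p.2]
}.

Section Graphs.
Variables (k : nat) (L : kgraph k).
Implicit Types (v : vertex L) (l m : L) (n : {ffun 'I_k -> nat}).

Definition paths_to v : set L := [set l | rng l = v].

Definition paths_to_deg v n : set L := paths_to v `&` [set l | deg l = n].

Definition paths_le n : set L :=
  [set l | degree_le (deg l) n /\
    forall i, (deg l i < n i)%N -> paths_to_deg (src l) (generator i) = set0].

Definition min_ext l m : set (L * L) :=
  [set p | [/\ src l = rng p.1, src m = rng p.2, kcomp l p.1 = kcomp m p.2 &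
    deg (kcomp l p.1) = degree_join (deg l) (deg m)]].

Definition finitely_aligned : Prop := forall l m, finite_set (min_ext l m).

Definition exhaustive v (E : set L) : Prop :=
  E `<=` paths_to v /\
  forall m, paths_to v m -> exists2 l, E l & min_ext l m !=set0.

Definition row_finite : Prop :=
  forall v i, finite_set (paths_to_deg v (generator i)).

Definition locally_convex : Prop :=
  forall i j v l, i <> j -> paths_to_deg v (generator i) l ->
    paths_to_deg v (generator j) !=set0 ->
    paths_to_deg (src l) (generator j) !=set0.

End Graphs.

Section Families.
Variables (R : realType) (A : cstarAlgType R) (k : nat) (L : kgraph k).
Variable t : L -> A.

Definition gap (v : vertex L) (l : L) : A := t (idp v) - t l ** star (t l).

(* An exhaustive set is nonempty, because idp v must meet one of its elements;
   so a finite one is enumerated as l :: E, and the product over it needs no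
   unit. It is required to vanish for every enumeration; the factors commute by
   the preceding conditions, so the order is immaterial. Finite alignment is
   what makes the sums over [min_ext l m] finite ([\sum_(_ \in _)] is 0 by
   convention over an infinite support). *)
Record ck_family : Prop := CKFamily {
  ck_aligned : finitely_aligned L;
  ck_isometry : forall l, partial_isometry (t l);
  ck_vertex : orthogonal_projections (fun v => t (idp v));
  ck_comp : forall l m, src l = rng m -> t l ** t m = t (kcomp l m);
  ck_min : forall l m, star (t l) ** t m =
    \sum_(p \in min_ext l m) (t p.1 ** star (t p.2));
  ck_exhaustive : forall v (l : L) (E : seq L), uniq (l :: E) ->
    exhaustive v [set` l :: E] ->
    foldl (fun x m => x ** gap v m) (gap v l) E = 0
}.

Record row_finite_ck_family : Prop := RowFiniteCKFamily {
  rck_vertex : orthogonal_projections (fun v => t (idp v));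
  rck_comp : forall l m, src l = rng m -> t l ** t m = t (kcomp l m);
  rck_src : forall l, star (t l) ** t l = t (idp (src l));
  rck_sum : forall v n, t (idp v) =
    \sum_(l \in paths_to v `&` paths_le n) (t l ** star (t l))
}.

End Families.

Section OneGraphFamilies.
Variables (R : realType) (A : cstarAlgType R) (L : kgraph 1) (t : L -> A).

Definition edge : set L := [set e | deg e = generator ord0].

Record graph_ck_family : Prop := GraphCKFamily {
  gck_vertex : orthogonal_projections (fun v => t (idp v));
  gck_comp : forall l m, src l = rng m -> t l ** t m = t (kcomp l m);
  gck_src : forall e, edge e -> star (t e) ** t e = t (idp (src e));
  gck_orth : forall e f, edge e -> edge f -> e <> f ->
    (t e ** star (t e)) ** (t f ** star (t f)) = 0;
  gck_le : forall e, edge e -> cle (t e ** star (t e)) (t (idp (rng e)));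
  gck_sum : forall v, paths_to v `&` edge !=set0 ->
    finite_set (paths_to v `&` edge) ->
    t (idp v) = \sum_(e \in paths_to v `&` edge) (t e ** star (t e))
}.

End OneGraphFamilies.

(* Main.v *)
From mathcomp Require Import all_boot all_order all_algebra finmap.
From mathcomp Require Import boolp classical_sets functions cardinality fsbigop.
From mathcomp Require Import reals topology normedtype complex.
From mathcomp Require Import zify lra.
Require Import Defs.

(** In every family considered here [t_l^* t_l = t_(src l)], so the range
    projections [t_l t_l^*] control everything. For pairwise orthogonal range
    projections indexed by a finite set E, the product of the gaps
    [t_v - t_l t_l^*] over E is [t_v - \sum_(l in E) t_l t_l^*]. Hence (iv)
    turns into a summation formula as soon as E is exhaustive and no two of its
    elements have a common extension; edges into v and v Lambda^(<= n) are such.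

    Conversely, for a row-finite family the sum relation forces the range
    projections over v Lambda^(<= n) to be orthogonal. This is the only place
    where the C*-norm matters, and it reduces to the fact that the unit of a
    Banach algebra is an extreme point of the unit ball. Relation (iii) follows
    by expanding [t_l] and [t_m] over paths up to the degree
    [d(l) \vee d(m)]. For (iv) one shows that [t_a^*] kills the product for all
    paths a into v that are long enough to have a prefix in the exhaustive set;
    the sum relations then propagate this down to [a = v]. *)

Set Implicit Arguments.
Unset Strict Implicit.
Unset Printing Implicit Defensive.

Import Order.TTheory GRing.Theory Num.Theory.

Local Open Scope classical_set_scope.
Local Open Scope ring_scope.
Local Open Scope complex_scope.
Local Open Scope cstar_scope.

(** * C*-algebras *)

Section Algebra.
Variables (R : realType) (A : cstarAlgType R).
Implicit Types (x y z p q g : A).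

Lemma cmul0r : right_zero (0 : A) cmul.
Proof. by move=> x; apply: (addrI (x ** 0)); rewrite -cmulDr !addr0. Qed.

Lemma cmul0l : left_zero (0 : A) cmul.
Proof. by move=> x; apply: (addrI (0 ** x)); rewrite -cmulDl !addr0. Qed.

Lemma cmulNr x y : x ** - y = - (x ** y).
Proof. by apply: (addrI (x ** y)); rewrite -cmulDr !subrr cmul0r. Qed.

Lemma cmulNl x y : (- x) ** y = - (x ** y).
Proof. by apply: (addrI (x ** y)); rewrite -cmulDl !subrr cmul0l. Qed.

Lemma cmulBr x y z : x ** (y - z) = x ** y - x ** z.
Proof. by rewrite cmulDr cmulNr. Qed.

Lemma cmulBl x y z : (x - y) ** z = x ** z - y ** z.
Proof. by rewrite cmulDl cmulNl. Qed.

Lemma cmul_sumr (I : Type) (s : seq I) (P : pred I) (F : I -> A) x :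
  x ** (\sum_(i <- s | P i) F i) = \sum_(i <- s | P i) x ** F i.
Proof. by apply: (big_morph (cmul x)); [exact: cmulDr | exact: cmul0r]. Qed.

Lemma cmul_suml (I : Type) (s : seq I) (P : pred I) (F : I -> A) x :
  (\sum_(i <- s | P i) F i) ** x = \sum_(i <- s | P i) F i ** x.
Proof.
by apply: (big_morph (cmul^~ x)) => [y z|]; rewrite ?cmulDl ?cmul0l.
Qed.

Lemma star0 : star (0 : A) = 0.
Proof. by apply: (addrI (star 0)); rewrite -starD !addr0. Qed.

Lemma starN x : star (- x) = - star x.
Proof. by apply: (addrI (star x)); rewrite -starD !subrr star0. Qed.

Lemma starB x y : star (x - y) = star x - star y.
Proof. by rewrite starD starN. Qed.

Lemma star_sum (I : Type) (s : seq I) (P : pred I) (F : I -> A) :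
  star (\sum_(i <- s | P i) F i) = \sum_(i <- s | P i) star (F i).
Proof. by apply: big_morph; [exact: starD | exact: star0]. Qed.

Lemma star_mul_eq0 x : star x ** x = 0 -> x = 0.
Proof.
move=> x0; apply/eqP; rewrite -normr_eq0 -sqrf_eq0 -cnorm_star x0.
by rewrite normr0.
Qed.

(* A real-valued copy of the norm, because the order of R[i] is partial. *)
Definition rnorm x : R := complex.Re `|x|.

Lemma rnormE x : (rnorm x)%:C = `|x|.
Proof. exact: RRe_real (normr_real x). Qed.

Lemma rnorm_ge0 x : 0 <= rnorm x.
Proof. by rewrite -ler0c rnormE. Qed.

Lemma rnormD x y : rnorm (x + y) <= rnorm x + rnorm y.
Proof. by rewrite -lecR rmorphD /= !rnormE ler_normD. Qed.

Lemma rnormN x : rnorm (- x) = rnorm x.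
Proof. by rewrite /rnorm normrN. Qed.

Lemma rnormMn x n : rnorm (x *+ n) = rnorm x *+ n.
Proof. by apply: complexI; rewrite rmorphMn /= !rnormE normrMn. Qed.

Lemma rnormM x y : rnorm (x ** y) <= rnorm x * rnorm y.
Proof. by rewrite -lecR rmorphM /= !rnormE cnormM. Qed.

Lemma rnorm_eq0 x : rnorm x = 0 -> x = 0.
Proof. by move=> x0; apply/eqP; rewrite -normr_eq0 -rnormE x0. Qed.

Lemma rnorm_sum (I : Type) (s : seq I) (F : I -> A) :
  rnorm (\sum_(i <- s) F i) <= \sum_(i <- s) rnorm (F i).
Proof.
elim/big_rec2: _ => [|i a x _ le_xa]; first by rewrite /rnorm normr0.
by apply: le_trans (rnormD _ _) _; rewrite lerD2l.
Qed.

Lemma rnormM_le1 x y : rnorm x <= 1 -> rnorm y <= 1 -> rnorm (x ** y) <= 1.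
Proof.
move=> x1 y1; apply: le_trans (rnormM _ _) _.
by rewrite mulr_ile1 ?rnorm_ge0.
Qed.

Lemma rnorm_projection p : projection p -> rnorm p <= 1.
Proof.
move=> [pp ps]; have : rnorm p = rnorm p ^+ 2.
  by apply: complexI; rewrite rmorphXn /= rnormE -cnorm_star ps pp.
by have := rnorm_ge0 p; nra.
Qed.

Lemma cmulMnr x y n : x ** (y *+ n) = (x ** y) *+ n.
Proof. by elim: n => [|n IH]; rewrite ?mulr0n ?cmul0r // !mulrS cmulDr IH. Qed.

Lemma cmulMnl x y n : (x *+ n) ** y = (x ** y) *+ n.
Proof. by elim: n => [|n IH]; rewrite ?mulr0n ?cmul0l // !mulrS cmulDl IH. Qed.

Lemma scale_natK n x : ((n.+1%:R : R[i])^-1 *: x) *+ n.+1 = x.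
Proof. by rewrite -scaler_nat scalerA divff ?scale1r // pnatr_eq0. Qed.

(** * The unit of a corner as an extreme point of its unit ball *)

Section Extreme.
Variables (p g : A).
Hypotheses (pp : p ** p = p) (pg : p ** g = g) (gp : g ** p = g).

(** Integer polynomials in [g] of degree at most 3, with [p] in the role of 1; identities in the
    corner become computations on coefficients. *)
Let comb (a b c d : int) : A :=
  p *~ a + g *~ b + (g ** g) *~ c + (g ** g ** g) *~ d.

Let combD a b c d a' b' c' d' :
  comb a b c d + comb a' b' c' d' = comb (a + a') (b + b') (c + c') (d + d').
Proof.
rewrite /comb !mulrzDr addrACA; congr (_ + _).
by rewrite addrACA; congr (_ + _); rewrite addrACA.
Qed.

Let combN a b c d : - comb a b c d = comb (- a) (- b) (- c) (- d).
Proof. by rewrite /comb !opprD !mulrNz. Qed.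

Let cmulz x y (n : int) : x ** (y *~ n) = (x ** y) *~ n.
Proof.
by case: n => n; rewrite ?NegzE ?mulrNz ?cmulNr -?pmulrn cmulMnr.
Qed.

Let mul_comb a b c : (p + g) ** comb a b c 0 = comb a (a + b) (b + c) c.
Proof.
have -> : (p + g) ** comb a b c 0 = comb a b c 0 + comb 0 a b c.
  rewrite /comb !mulr0z !addr0 !add0r cmulDl !cmulDr !cmulz pp pg gp.
  by rewrite !cmulA pg.
by rewrite combD add0r addr0 [a + b]addrC [b + c]addrC.
Qed.

Let add_comb : p + g = comb 1 1 0 0.
Proof. by rewrite /comb !mulr0z !addr0 !mulr1z. Qed.

(** [f] is given through its double so that [(p + f) *+ 4] has integer coefficients. This element is
    the product of two copies of [p + g] and of [(p + g) + (p - g) *+ 3], whose norm is at most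
    [1 + 3]. *)
Lemma cubic_rnorm f : f *+ 2 = g *+ 3 - g ** g ** g ->
  rnorm (p + g) <= 1 -> rnorm (p - g) <= 1 -> rnorm (p + f) <= 1.
Proof.
move=> f2 u1 w1.
have E : (p + f) *+ 4 = (p + g) ** ((p + g) ** ((p + g) + (p - g) *+ 3)).
  have -> : (p + g) + (p - g) *+ 3 = comb 4%:Z (- 2%:Z) 0 0.
    rewrite /comb !mulr0z !addr0 mulrNz -!pmulrn mulrnBl addrACA -mulrS.
    by rewrite [g *+ 3]mulrS opprD addNKr.
  rewrite !mul_comb mulrnDl (mulrnA f 2 2) f2 mulrnBl -mulrnA.
  rewrite -[RHS]/(comb 4%:Z 6%:Z 0 (- 2%:Z)).
  by rewrite /comb mulr0z addr0 mulrNz -!pmulrn addrA.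
have : rnorm ((p + f) *+ 4) <= 4.
  rewrite E; apply: le_trans (rnormM _ _) _.
  have h : rnorm ((p + g) ** ((p + g) + (p - g) *+ 3)) <= 4.
    apply: le_trans (rnormM _ _) _.
    have h : rnorm ((p + g) + (p - g) *+ 3) <= 4.
      by apply: le_trans (rnormD _ _) _; rewrite rnormMn; lra.
    by have := rnorm_ge0 (p + g); have := rnorm_ge0 ((p + g) + (p - g) *+ 3); nra.
  by have := rnorm_ge0 (p + g);
    have := rnorm_ge0 ((p + g) ** ((p + g) + (p - g) *+ 3)); nra.
by rewrite rnormMn; lra.
Qed.

(** The squares of [p + g] and [p - g] are contractions that differ by [g *+ 4]. *)
Lemma rnorm_corner_le : rnorm (p + g) <= 1 -> rnorm (p - g) <= 1 ->
  rnorm g *+ 4 <= 2.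
Proof.
move=> u1 w1; rewrite -rnormMn.
have -> : g *+ 4 = (p + g) ** (p + g) - (p - g) ** (p - g).
  have -> : (p - g) ** (p - g) = comb 1 (- 2%:Z) 1 0.
    rewrite !cmulBl !cmulBr pp pg gp opprB [g ** g - g]addrC addrACA addrA.
    by rewrite /comb mulr0z addr0 mulrNz -pmulrn !mulr1z mulr2n opprD addrA.
  rewrite {2}add_comb mul_comb combN combD.
  by rewrite -[RHS]/(comb 0 4%:Z 0 0) /comb !mulr0z !addr0 add0r.
apply: le_trans (rnormD _ _) _; rewrite rnormN.
by have := rnormM_le1 u1 u1; have := rnormM_le1 w1 w1; lra.
Qed.

End Extreme.

(* The unit [p] of a corner is an extreme point of its unit ball. If
   [p + g] and [p - g] lie in the ball, then so do [p + f] and [p - f] for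
   [f = (3 g - g^3) / 2], as [p + f = u^2 (u + 3 w) / 4] with [u = p + g] and
   [w = p - g]. Since [|g| <= 1/2], this [f] satisfies [|f| >= 5/4 |g|], and
   iterating [f] would make the norm grow without bound. *)
Lemma unit_extreme p g : p ** p = p -> p ** g = g -> g ** p = g ->
  rnorm (p + g) <= 1 -> rnorm (p - g) <= 1 -> g = 0.
Proof.
move=> pp pg gp u1 w1; apply: rnorm_eq0.
(* Linear growth is enough: [5 |g| <= 4 |f|] implies [(n + 5) |g| <= (n + 4) |f|], so the bound for
   [f] at [n] yields the one for [g] at [n.+1]. *)
have bnd n : rnorm g *+ (n + 4) <= 2.
  elim: n g pg gp u1 w1 => [|n IH] {}g pg gp u1 w1.
    exact: rnorm_corner_le pp pg gp u1 w1.
  set f := (2%:R : R[i])^-1 *: (g *+ 3 - g ** g ** g).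
  have f2 : f *+ 2 = g *+ 3 - g ** g ** g by rewrite scale_natK.
  have pf : p ** f = f by rewrite -cscaleAr cmulBr cmulMnr !cmulA pg.
  have fp : f ** p = f.
    by rewrite -cscaleAl cmulBl cmulMnl gp -[g ** g ** g ** p]cmulA gp.
  have f1 : rnorm (p + f) <= 1 by exact: cubic_rnorm pp pg gp f f2 u1 w1.
  have f1' : rnorm (p - f) <= 1.
    apply: (@cubic_rnorm p (- g)) => //; rewrite ?cmulNr ?cmulNl ?pg ?gp //.
      by rewrite !mulNrn f2 !opprK opprB addrC.
    by rewrite opprK.
  have := rnorm_corner_le pp pg gp u1 w1.
  have := IH f pf fp f1 f1'.
  rewrite -[_ *+ (n + 4)]mulr_natr -[_ *+ (n.+1 + 4)]mulr_natr !natrD.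
  rewrite -[n.+1%:R]natr1.
  have : rnorm g *+ 3 <= rnorm f *+ 2 + rnorm g * rnorm g * rnorm g.
    rewrite -!rnormMn f2 -lerBlDr.
    have := rnormD (g *+ 3 - g ** g ** g) (g ** g ** g); rewrite subrK => h.
    rewrite lerBlDr; apply: le_trans h _; rewrite lerD2l.
    apply: le_trans (rnormM _ _) _.
    by rewrite ler_wpM2r ?rnorm_ge0 // rnormM.
  have := rnorm_ge0 f; have := rnorm_ge0 g; have := ler0n R n.
  move: (rnorm g) (rnorm f) n%:R => a b m m0 a0 b0 h1 h2 h3.
  (* As [|g| <= 1/2], the cubic term is at most [|g| / 4]. *)
  have h4 : 5 * a <= 4 * b.
    have : a * a * a <= a / 4 by nra.
    by lra.
  have h5 : 0 <= (4 * b - 5 * a) * (m + 4) by apply: mulr_ge0; lra.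
  by have := mulr_ge0 a0 m0; lra.
apply/eqP/negP => /negP gn0; have g0 : 0 < rnorm g.
  by rewrite lt_def gn0 rnorm_ge0.
have h0 : 0 <= 2 / rnorm g by rewrite divr_ge0 ?rnorm_ge0.
have := bnd (Num.bound (2 / rnorm g)); have := Num.Theory.archi_boundP h0.
rewrite ltr_pdivrMr // -[_ *+ (_ + _)]mulr_natr natrD; nra.
Qed.

(** * Sums of projections and products of their complements *)

Lemma projectionB q p : projection q -> projection p -> q ** p = p ->
  projection (q - p).
Proof.
move=> [qq qs] [pp ps] qp.
have pq : p ** q = p by rewrite -ps -qs -starM qp.
split; last by rewrite starB qs ps.
by rewrite cmulBl !cmulBr qq qp pq pp subrr subr0.
Qed.

Lemma orthogonal_of_sum_projections (I : eqType) (s : seq I) (P : I -> A) q :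
  uniq s -> projection q -> (forall i, i \in s -> projection (P i)) ->
  (forall i, i \in s -> q ** P i = P i) -> \sum_(i <- s) P i = q ->
  forall i j, i \in s -> j \in s -> i != j -> P i ** P j = 0.
Proof.
move=> us qproj Pproj qP sumP i j si sj ij.
have [[pp ps] [pp' ps']] := (Pproj i si, Pproj j sj).
have sj' : j \in rem i s by rewrite mem_rem_uniq // inE eq_sym ij.
set s' := rem j (rem i s).
have sub_s' l : l \in s' -> l \in s by move/mem_rem/mem_rem.
have sumE : P i + (P j + \sum_(l <- s') P l) = q.
  by rewrite -sumP (perm_big _ (perm_to_rem si)) /= big_cons
     (perm_big _ (perm_to_rem sj')) /= big_cons.
(* Cutting the sum down by [P i] gives [a + \sum_(l in s') P i P l P i = 0].
   Both [P i - a] and the [P i - P i P l P i] are contractions, so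
   [P i + a / N] and [P i - a / N] are contractions for [N = size s' + 1]. *)
set a := P i ** P j ** P i.
have aE : \sum_(l <- s') P i ** P l ** P i = - a.
  have : P i ** q ** P i = P i by rewrite -cmulA qP // pp.
  rewrite -sumE !cmulDr !cmulDl !pp => /(canRL (addKr _)).
  rewrite addNr cmul_sumr cmul_suml => /eqP.
  by rewrite addrC addr_eq0 => /eqP.
have term l : l \in s -> rnorm (P i - P i ** P l ** P i) <= 1.
  move=> sl; have -> : P i - P i ** P l ** P i = P i ** (q - P l) ** P i.
    by rewrite cmulBr cmulBl -[P i ** q ** _]cmulA qP // pp.
  have pi1 := rnorm_projection (Pproj i si).
  apply: rnormM_le1 => //; apply: rnormM_le1 => //.
  by apply: rnorm_projection; apply: projectionB; [|exact: Pproj|exact: qP].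
have rest : rnorm (P i *+ size s' + a) <= (size s')%:R.
  have -> : P i *+ size s' + a = \sum_(l <- s') (P i - P i ** P l ** P i).
    by rewrite big_split /= sumrN aE opprK big_const_seq count_predT iter_addr_0.
  apply: le_trans (rnorm_sum _ _) _.
  rewrite -sum1_size natr_sum !big_seq; apply: ler_sum => l /sub_s'.
  exact: term.
pose g := ((size s').+1%:R : R[i])^-1 *: a.
have gE : g *+ (size s').+1 = a by rewrite scale_natK.
have shrink x : rnorm (x *+ (size s').+1) <= (size s').+1%:R -> rnorm x <= 1.
  by rewrite rnormMn lerMn2r.
have pa : P i ** a = a by rewrite !cmulA pp.
have ap : a ** P i = a by rewrite -cmulA pp.
have pi1 := rnorm_projection (Pproj i si).
have g0 : g = 0.
  apply: (@unit_extreme (P i)) => //.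
  - by rewrite -cscaleAr pa.
  - by rewrite -cscaleAl ap.
  (* Multiplied by [(size s').+1], [P i + g] is [P i] plus the element bounded in [rest], while
     [P i - g] is [P i *+ size s'] plus [P i - a], which [term] bounds at [j]. *)
  - apply: shrink; rewrite mulrnDl gE mulrS -addrA -natr1 addrC.
    by apply: le_trans (rnormD _ _) _; rewrite lerD.
  - apply: shrink; rewrite mulrnBl gE mulrSr -addrA -natr1.
    apply: le_trans (rnormD _ _) _; rewrite lerD ?term //.
    by rewrite rnormMn lerMn2r pi1 orbT.
have a0 : a = 0 by rewrite -gE g0 mul0rn.
(* [a] is [star y ** y] for [y = P j ** P i]. *)
have : P j ** P i = 0.
  by apply: star_mul_eq0; rewrite starM ps ps' cmulA -[_ ** P j ** P j]cmulA pp'.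
by move/(congr1 star); rewrite starM ps ps' star0.
Qed.

(** The accumulator [a] is the sum of the projections already treated: by orthogonality each step is
    [(q - a) ** (q - P i) = q - (a + P i)]. *)
Lemma foldl_projections (I : eqType) (P : I -> A) q a s :
  q ** q = q -> a ** q = a -> uniq s ->
  (forall i, i \in s -> q ** P i = P i) ->
  (forall i, i \in s -> P i ** q = P i) ->
  (forall i, i \in s -> a ** P i = 0) ->
  (forall i j, i \in s -> j \in s -> i != j -> P i ** P j = 0) ->
  foldl (fun x i => x ** (q - P i)) (q - a) s = q - (a + \sum_(i <- s) P i).
Proof.
move=> qq; elim: s a => [|i s IH] a aq /=; first by rewrite big_nil addr0.
move=> /andP[nsi us] qP Pq aP PP.
have is_i : i \in i :: s by rewrite mem_head.
have in_s j : j \in s -> j \in i :: s by rewrite inE orbC => ->.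
rewrite cmulBl !cmulBr qq aq qP // aP // subr0 -addrA -opprD [P i + a]addrC.
rewrite IH ?big_cons ?addrA // ?cmulDl ?aq ?Pq //.
- by move=> j /in_s; exact: qP.
- by move=> j /in_s; exact: Pq.
- move=> j sj; rewrite cmulDl aP ?PP ?addr0 // ?in_s //.
  by apply: contraNneq nsi => ->.
- by move=> j l /in_s sj /in_s sl; exact: PP.
Qed.

(** Since the factors commute, the one killed by [z] can be moved to the front. *)
Lemma foldl_cmul_eq0 (I : eqType) (G : I -> A) z l s m :
  (forall i j, G i ** G j = G j ** G i) -> m \in l :: s -> z ** G m = 0 ->
  z ** foldl (fun x i => x ** G i) (G l) s = 0.
Proof.
move=> GC ms zm.
have step x : z ** x = 0 -> z ** foldl (fun x i => x ** G i) x s = 0.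
  elim: s x {ms} => //= i s IH x zx; apply: IH.
  by rewrite cmulA zx cmul0l.
move: ms; rewrite inE => /orP[/eqP lm|]; first by apply: step; rewrite -lm.
(* Invariant of the induction: until [m] is reached, the partial product commutes with [G m]. *)
have : G l ** G m = G m ** G l by [].
elim: s (G l) {step} => //= i s IH x xC; rewrite inE => /orP[/eqP mi|ms].
  have : z ** (x ** G i) = 0 by rewrite -mi xC cmulA zm cmul0l.
  elim: s (x ** G i) {IH xC} => //= j s IH y zy; apply: IH.
  by rewrite cmulA zy cmul0l.
by apply: IH => //; rewrite -cmulA GC !cmulA xC.
Qed.

Lemma foldl_cmul_id (I : Type) (G : I -> A) z x s :
  z ** x = x ->
  z ** foldl (fun x i => x ** G i) x s = foldl (fun x i => x ** G i) x s.
Proof. by elim: s x => //= i s IH x zx; apply: IH; rewrite cmulA zx. Qed.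

End Algebra.

(** * Higher-rank graphs *)

Section KGraph.
Variables (k : nat) (L : kgraph k).
Implicit Types (v w : vertex L) (l m a b c d : L) (n : {ffun 'I_k -> nat}).

Lemma deg_compE l m i : src l = rng m ->
  deg (kcomp l m) i = (deg l i + deg m i)%N.
Proof. by move=> lm; rewrite deg_comp // ffunE. Qed.

Lemma degree_le_antisym n n' : degree_le n n' -> degree_le n' n -> n = n'.
Proof. by move=> le1 le2; apply/ffunP => i; apply/eqP; rewrite eqn_leq le1 le2. Qed.

Lemma degree_eq0 n : (forall i, n i = 0%N) -> n = 0.
Proof. by move=> n0; apply/ffunP => i; rewrite n0 ffunE. Qed.

Lemma comp_factor l n : degree_le n (deg l) ->
  exists a b, [/\ src a = rng b, l = kcomp a b, deg a = n &
    deg b = [ffun i => (deg l i - n i)%N]].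
Proof.
move=> le_nl; have E : deg l = n + [ffun i => (deg l i - n i)%N].
  by apply/ffunP => i; rewrite !ffunE; have /= := le_nl i; lia.
by have [[a b] [[/= da db ab lE] _]] := factorisation E; exists a, b.
Qed.

Lemma comp_inj a b c d : src a = rng b -> src c = rng d -> deg a = deg c ->
  kcomp a b = kcomp c d -> a = c /\ b = d.
Proof.
move=> ab cd dac E; have dbd : deg b = deg d.
  apply/ffunP => i; have := deg_compE i ab.
  by rewrite E deg_compE // dac => /addnI.
have [p [_ puniq]] := factorisation (deg_comp ab).
have pab : p = (a, b) by apply: puniq.
have pcd : p = (c, d) by apply: puniq; rewrite /= dac dbd.
by move: pab; rewrite pcd => -[].
Qed.

Lemma comp_injl l a b : src l = rng a -> src l = rng b ->
  kcomp l a = kcomp l b -> a = b.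
Proof. by move=> la lb /(comp_inj la lb erefl)[]. Qed.

(** [l] factors both as [idp (rng l)] followed by [l] and as [l] followed by [idp (src l)]; in
    degree 0 uniqueness identifies the two. *)
Lemma deg0_idp l : deg l = 0 -> l = idp (rng l) /\ src l = rng l.
Proof.
move=> l0; have [|||| E _] := @comp_inj (idp (rng l)) l l (idp (src l)).
- by rewrite src_idp.
- by rewrite rng_idp.
- by rewrite deg_idp l0.
- by rewrite comp_idl comp_idr.
by split; [rewrite E | rewrite -{1}E src_idp].
Qed.

(** * Minimal common extensions *)

Lemma min_ext_swap l m p : min_ext l m p -> min_ext m l (p.2, p.1).
Proof.
case=> lp mp E D; split=> //=; rewrite -E D.
by apply/ffunP => i; rewrite !ffunE maxnC.
Qed.

Lemma min_ext_sym l m : min_ext m l = [set (p.2, p.1) | p in min_ext l m].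
Proof.
apply/seteqP; split=> [[a b] /min_ext_swap ?|_ [p /min_ext_swap ? <-]] //.
by exists (b, a).
Qed.

(** The join of the two degrees is [deg (kcomp a b)], so the second component has degree 0. *)
Lemma min_ext_prefix a b : src a = rng b ->
  min_ext a (kcomp a b) = [set (b, idp (src b))].
Proof.
move=> ab; apply/seteqP; split=> [[c d]|_ ->]; last first.
  split=> //=; rewrite ?rng_idp ?src_comp //.
    by rewrite -(src_comp ab) comp_idr.
  by apply/ffunP => i; rewrite ffunE deg_compE //; lia.
case=> /= ac abd E D; have d0 : deg d = 0.
  apply: degree_eq0 => i; move/ffunP/(_ i): D.
  by rewrite E deg_compE // ffunE deg_compE //; lia.
have [dE sd] := deg0_idp d0.
have dE' : d = idp (src (kcomp a b)) by rewrite abd -dE.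
have <- : b = c; first by apply: (@comp_injl a); rewrite // E dE' comp_idr.
by rewrite dE' src_comp.
Qed.

Lemma min_ext_self l : min_ext l l = [set (idp (src l), idp (src l))].
Proof.
have E : src l = rng (idp (src l)) by rewrite rng_idp.
by rewrite -{2}[l]comp_idr min_ext_prefix // src_idp.
Qed.

Lemma min_ext_rng l m : min_ext l m !=set0 -> rng l = rng m.
Proof. by case=> -[a b] [/= la mb E _]; rewrite -(rng_comp la) E rng_comp. Qed.

Lemma min_ext_eq_deg l m : deg l = deg m -> min_ext l m !=set0 -> l = m.
Proof. by move=> dlm [[a b] [/= la mb E _]]; case: (comp_inj la mb dlm E). Qed.

(** Any common extension contains a minimal one: cut it at the join of the degrees; by unique
    factorisation [l] and [m] are prefixes of the initial piece. *)
Lemma min_ext_common l m a b : src l = rng a -> src m = rng b ->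
  kcomp l a = kcomp m b -> min_ext l m !=set0.
Proof.
move=> la mb E.
have [c [d [cd cdE dc _]]] : exists c d, [/\ src c = rng d,
    kcomp l a = kcomp c d, deg c = degree_join (deg l) (deg m) &
    deg d = [ffun i => (deg (kcomp l a) i - degree_join (deg l) (deg m) i)%N]].
  apply: comp_factor => i; rewrite ffunE geq_max {2}E.
  by rewrite !deg_compE // !leq_addr.
have prefix x y : src x = rng y -> kcomp x y = kcomp c d ->
    degree_le (deg x) (deg c) -> exists2 z, src x = rng z & c = kcomp x z.
  move=> xy xyE /comp_factor[x' [z [x'z cE dx' _]]].
  have zd : src z = rng d by rewrite -cd cE src_comp.
  have [||xx' _] := @comp_inj x y x' (kcomp z d) xy _ (esym dx').
  - by rewrite rng_comp.
  - by rewrite compA // -cE.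
  by exists z; rewrite xx'.
have [|z lz cz] := prefix l a la cdE.
  by move=> i; rewrite dc ffunE leq_maxl.
have [|z' mz' cz'] := prefix m b mb (etrans (esym E) cdE).
  by move=> i; rewrite dc ffunE leq_maxr.
by exists (z, z'); split=> //=; rewrite -cz.
Qed.

(** * Finiteness in row-finite graphs *)

Lemma finite_paths_to_deg : row_finite L ->
  forall v n, finite_set (paths_to_deg v n).
Proof.
move=> fin v n; move sE: (\sum_i n i)%N => s.
elim: s v n sE => [|s IH] v n sE.
  have n0 : n = 0.
    apply: degree_eq0 => i; apply/eqP.
    by move/eqP: sE; rewrite sum_nat_eq0 => /forallP/(_ i).
  apply: (@sub_finite_set _ _ [set idp v]) => // l [/= lv dl].
  by case: (deg0_idp (etrans dl n0)) => -> _; rewrite lv.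
have [i ni] : exists i, (0 < n i)%N.
  apply/existsP; apply: contra_eqT sE; rewrite negb_exists => /forallP n0.
  by rewrite big1 // => i _; apply/eqP; rewrite -leqn0 leqNgt n0.
pose n' := [ffun j => (n j - generator i j)%N].
apply: (@sub_finite_set _ _ (\bigcup_(e in paths_to_deg v (generator i))
   (kcomp e @` paths_to_deg (src e) n'))).
  move=> l [/= lv dl]; have [|e [f [ef lE de df]]] := @comp_factor l (generator i).
    by move=> j; rewrite dl ffunE; case: eqP => // ->.
  exists e; first by split=> //=; rewrite -lv lE rng_comp.
  by exists f => //; split=> //=; rewrite df dl.
apply: bigcup_finite => [|e _]; first exact: fin.
apply: finite_image; apply: IH; apply/eqP; rewrite -eqSS -sE; apply/eqP.
rewrite (bigD1 i) //= [RHS](bigD1 i) //= !ffunE eqxx -addSn subn1 prednK //.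
congr addn; apply: eq_bigr => j ji; rewrite !ffunE.
by rewrite (negPf ji) subn0.
Qed.

Lemma finite_degree_le n : finite_set [set n' | degree_le n' n].
Proof.
pose N := (\max_i n i)%N.
apply: (@sub_finite_set _ _
  (range (fun f : {ffun 'I_k -> 'I_N.+1} => [ffun i => nat_of_ord (f i)]))).
  move=> n' /= le_n'; exists [ffun i => inord (n' i)] => //.
  apply/ffunP => i; rewrite !ffunE inordK // ltnS.
  exact: leq_trans (le_n' i) (leq_bigmax i).
by apply: finite_image; exact: finite_finset.
Qed.

Lemma finite_paths_le v n : row_finite L ->
  finite_set (paths_to v `&` paths_le n).
Proof.
move=> fin; apply: (@sub_finite_set _ _
  (\bigcup_(n' in [set n' | degree_le n' n]) paths_to_deg v n')).
  by move=> l [/= lv [dl _]]; exists (deg l).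
by apply: bigcup_finite => [|n' _];
  [exact: finite_degree_le | exact: finite_paths_to_deg].
Qed.

(** The degrees of both components of a minimal extension are prescribed by [l] and [m]. *)
Lemma row_finite_aligned : row_finite L -> finitely_aligned L.
Proof.
move=> fin l m; pose J := degree_join (deg l) (deg m).
apply: (@sub_finite_set _ _
  (paths_to_deg (src l) [ffun i => (J i - deg l i)%N] `*`
   paths_to_deg (src m) [ffun i => (J i - deg m i)%N])).
  move=> [a b] [/= la mb E D]; split; split=> //=; apply/ffunP => i.
    by rewrite [RHS]ffunE /J -D deg_compE // addKn.
  by rewrite [RHS]ffunE /J -D E deg_compE // addKn.
by apply: finite_setX; exact: finite_paths_to_deg.
Qed.

(** * Maximal paths within a degree bound, and local convexity *)

Lemma deg_generator_prefix l i : (0 < deg l i)%N ->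
  paths_to_deg (rng l) (generator i) !=set0.
Proof.
move=> li; have [|e [f [ef lE de _]]] := @comp_factor l (generator i).
  by move=> j; rewrite ffunE; case: eqP => // ->.
by exists e; split=> //=; rewrite lE rng_comp.
Qed.

Lemma paths_le_extension w n : exists2 l, rng l = w & paths_le n l.
Proof.
(* [s] bounds the total degree still available; a path outside [paths_le n] can be lengthened by an
   edge, which uses up one unit of it. *)
suff ext s l : rng l = w -> degree_le (deg l) n ->
    (\sum_i (n i - deg l i) <= s)%N -> exists2 l, rng l = w & paths_le n l.
  apply: (ext _ (idp w)) (leqnn _); first exact: rng_idp.
  by move=> i; rewrite deg_idp ffunE.
elim: s l => [|s IH] l lw dl small.
  exists l => //; split=> // i lt_i; exfalso.
  by move: small; rewrite (bigD1 i) //= leqNgt; lia.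
have [?|] := EM (paths_le n l); first by exists l.
move=> /not_andP[//|/existsNP[i /not_implyP[lt_i /eqP/set0P[e [/= er de]]]]].
have dle j : deg (kcomp l e) j = (deg l j + (j == i))%N.
  by rewrite deg_compE // de ffunE.
apply: (IH (kcomp l e)); first by rewrite rng_comp.
  by move=> j; rewrite dle; case: eqP => [->|_]; rewrite ?addn1 ?addn0.
rewrite -ltnS; apply: leq_trans small.
rewrite (bigD1 i) //= [X in (_ < X)%N](bigD1 i) //= dle eqxx.
rewrite -addSn leq_add //; first by move: lt_i; lia.
by apply: leq_sum => j /negPf ji; rewrite dle ji addn0.
Qed.

(** Local convexity is carried along [l] edge by edge; [deg l i = 0] ensures that no edge of [l] has
    direction [i]. *)
Lemma locally_convex_transport l i : locally_convex L -> deg l i = 0%N ->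
  paths_to_deg (rng l) (generator i) !=set0 ->
  paths_to_deg (src l) (generator i) !=set0.
Proof.
move=> lc; move sE: (\sum_j deg l j)%N => s; elim: s l sE => [|s IH] l sE li.
  have [|-> _] := @deg0_idp l; last by rewrite src_idp rng_idp.
  apply: degree_eq0 => j; apply/eqP.
  by move/eqP: sE; rewrite sum_nat_eq0 => /forallP/(_ j).
have [j lj] : exists j, (0 < deg l j)%N.
  apply/existsP; apply: contra_eqT sE; rewrite negb_exists => /forallP n0.
  by rewrite big1 // => j _; apply/eqP; rewrite -leqn0 leqNgt n0.
have [|e [f [ef lE de df]]] := @comp_factor l (generator j).
  by move=> j'; rewrite ffunE; case: eqP => // ->.
rewrite lE rng_comp // src_comp // => ne; apply: IH.
- apply/eqP; rewrite -eqSS -sE; apply/eqP.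
  rewrite (bigD1 j) //= [RHS](bigD1 j) //= df !ffunE eqxx -addSn subn1 prednK //.
  by congr addn; apply: eq_bigr => j' /negPf jj; rewrite !ffunE jj subn0.
- by rewrite df ffunE li.
rewrite -ef; apply: (lc j i) ne; last by split.
by move=> ji; move: lj; rewrite ji li.
Qed.

(** If [p.1] had positive degree in direction [i], then [deg l i < n i], as the join stays below
    [n]; an initial edge of [p.1] would then continue [l]. *)
Lemma paths_le_min_ext n l m p : paths_le n l -> degree_le (deg m) n ->
  min_ext l m p -> p.1 = idp (src l).
Proof.
move=> [dl top] dm [lp mp E D]; have p0 : deg p.1 = 0.
  apply: degree_eq0 => i; apply/eqP; rewrite -leqn0 leqNgt.
  apply/negP => pi; have := deg_compE i lp.
  have lt_i : (deg l i < n i)%N.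
    move: (dl i) (dm i) pi => h1 h2 h3.
    by move/ffunP/(_ i): D; rewrite deg_compE // ffunE; lia.
  by have := deg_generator_prefix pi; rewrite -lp (top i lt_i) => -[].
by rewrite lp; case: (deg0_idp p0).
Qed.

Lemma paths_le_exhaustive v n : locally_convex L ->
  exhaustive v (paths_to v `&` paths_le n).
Proof.
(* Extend m by some f in Lambda^(<= n - d(m)) and let l be the part of the
   extension of degree at most n: by local convexity a continuation of l in a
   direction i with [d(l)_i < n_i] would give one of f. *)
move=> lc; split=> [l []//|m /= mv].
have [f fm [df top]] := paths_le_extension (src m) [ffun i => (n i - deg m i)%N].
pose r := kcomp m f.
have [|l [b [lb rE dl db]]] := @comp_factor r [ffun i => minn (n i) (deg r i)].
  by move=> i; rewrite ffunE geq_minr.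
exists l; last exact: (@min_ext_common _ _ b f).
have lv : rng l = v by rewrite -mv -(rng_comp lb) -rE rng_comp.
split=> //; split=> [i|i]; rewrite dl ffunE; first by rewrite geq_minl.
move=> lt_i.
have fi : (deg f i < [ffun i => (n i - deg m i)%N] i)%N.
  by move: lt_i; rewrite ffunE /r deg_compE //; lia.
apply: contrapT => /eqP/set0P ne; have := top i fi; apply/eqP/set0P.
have -> : src f = src b by rewrite -(src_comp lb) -rE src_comp.
apply: locally_convex_transport lc _ _; last by rewrite -lb.
by rewrite db !ffunE; move: lt_i; lia.
Qed.

End KGraph.

(** * Families of partial isometries *)

(** Used to compare a sum over [min_ext l m] with a double sum over a rectangle of pairs. *)
Lemma fsum_filter (V : zmodType) (T : choiceType) (D : set T) (s : seq T)
    (F : T -> V) : uniq s -> D `<=` [set` s] ->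
  \sum_(x \in D) F x = \sum_(x <- s | x \in D) F x.
Proof.
move=> us Ds; have DE : D = [set` [seq x <- s | x \in D]].
  apply/seteqP; split=> x /=.
    by move=> Dx; rewrite mem_filter (Ds _ Dx) andbT mem_set.
  by rewrite mem_filter => /andP[/set_mem].
by rewrite -[RHS]big_filter [RHS]fsbig_seq ?filter_uniq // -DE.
Qed.

Section Family.
Variables (R : realType) (A : cstarAlgType R) (k : nat) (L : kgraph k).
Variable t : L -> A.
Hypothesis tv : orthogonal_projections (fun v => t (idp v)).
Hypothesis tM : forall l m, src l = rng m -> t l ** t m = t (kcomp l m).
Hypothesis tS : forall l, star (t l) ** t l = t (idp (src l)).
Implicit Types (v : vertex L) (l m a b : L).

Local Notation rproj l := (t l ** star (t l)).

Lemma vertex_projection v : projection (t (idp v)).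
Proof. by have [+ _] := tv; apply. Qed.

Lemma vertex_mul l : t (idp (rng l)) ** t l = t l.
Proof. by rewrite tM ?comp_idl // src_idp. Qed.

Lemma mul_vertex l : t l ** t (idp (src l)) = t l.
Proof. by rewrite tM ?comp_idr // rng_idp. Qed.

Lemma vertex_star l : t (idp (src l)) ** star (t l) = star (t l).
Proof.
by rewrite -{2}(mul_vertex l) starM; have [_ ->] := vertex_projection (src l).
Qed.

Lemma star_vertex l : star (t l) ** t (idp (rng l)) = star (t l).
Proof.
by rewrite -{2}(vertex_mul l) starM; have [_ ->] := vertex_projection (rng l).
Qed.

Lemma mul_star_mul l : t l ** star (t l) ** t l = t l.
Proof. by rewrite -cmulA tS mul_vertex. Qed.

Lemma star_mul_star l : star (t l) ** rproj l = star (t l).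
Proof. by rewrite cmulA tS vertex_star. Qed.

Lemma range_projection l : projection (rproj l).
Proof. by split; rewrite ?starM ?starK // cmulA mul_star_mul. Qed.

Lemma star_mul_eq0_rng l m : rng l <> rng m -> star (t l) ** t m = 0.
Proof.
move=> lm; rewrite -(star_vertex l) -(vertex_mul m) -cmulA [t (idp _) ** _]cmulA.
by have [_ ->] := tv; rewrite // cmul0l cmul0r.
Qed.

Lemma range_orthogonal l m : rproj l ** rproj m = 0 <-> star (t l) ** t m = 0.
Proof.
split=> lm; last by rewrite -cmulA [star (t l) ** _]cmulA lm cmul0l cmul0r.
have -> : star (t l) ** t m = star (t l) ** (rproj l ** rproj m) ** t m.
  by rewrite cmulA star_mul_star -cmulA mul_star_mul.
by rewrite lm cmul0r cmul0l.
Qed.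

Lemma vertex_range v l : rng l = v -> t (idp v) ** rproj l = rproj l.
Proof. by move<-; rewrite cmulA vertex_mul. Qed.

Lemma range_vertex v l : rng l = v -> rproj l ** t (idp v) = rproj l.
Proof. by move<-; rewrite -cmulA star_vertex. Qed.

(** The range projection of a path lies under that of its prefix [m], hence is orthogonal to the gap
    at [m]. *)
Lemma star_gap l m b : src m = rng b -> l = kcomp m b ->
  star (t l) ** gap t (rng l) m = 0.
Proof.
move=> mb ->; rewrite rng_comp // -tM // starM /gap cmulBr -!cmulA star_vertex.
by rewrite star_mul_star subrr.
Qed.

Lemma foldl_gap v l E : uniq (l :: E) -> [set` l :: E] `<=` paths_to v ->
  (forall m n, m \in l :: E -> n \in l :: E -> m != n -> star (t m) ** t n = 0) ->
  foldl (fun x m => x ** gap t v m) (gap t v l) E =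
  t (idp v) - \sum_(m <- l :: E) rproj m.
Proof.
move=> uE Ev orth; have [vv _] := vertex_projection v.
have Erng m : m \in l :: E -> rng m = v by move/Ev.
have inE' m : m \in E -> m \in l :: E by rewrite inE orbC => ->.
have porth m n : m \in l :: E -> n \in l :: E -> m != n -> rproj m ** rproj n = 0.
  by move=> mE nE mn; apply/range_orthogonal; exact: orth.
rewrite big_cons; apply: foldl_projections => //.
- by apply: range_vertex; apply: Erng; rewrite mem_head.
- by case/andP: uE.
- by move=> m /inE' /Erng /vertex_range.
- by move=> m /inE' /Erng /range_vertex.
- move=> m mE; apply: porth; rewrite ?mem_head ?inE' //.
  by apply: contraTneq mE => <-; case/andP: uE.
- by move=> m n /inE' mE /inE' nE; exact: porth.
Qed.

Section MinExt.
Hypothesis aligned : finitely_aligned L.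
Hypothesis tmin : forall l m, star (t l) ** t m =
  \sum_(p \in min_ext l m) (t p.1 ** star (t p.2)).

(** By (iii) the product is a sum of range projections of common extensions, hence self-adjoint, and
    self-adjoint elements with self-adjoint product commute. *)
Lemma range_comm l m : rproj l ** rproj m = rproj m ** rproj l.
Proof.
have sa : star (rproj l ** rproj m) = rproj l ** rproj m.
  have E : rproj l ** rproj m =
      \sum_(p <- fset_set (min_ext l m)) rproj (kcomp l p.1).
    have -> : rproj l ** rproj m = t l ** (star (t l) ** t m) ** star (t m).
      by rewrite !cmulA.
    rewrite tmin fsbig_finite // cmul_sumr cmul_suml; apply: eq_big_seq => p.
    rewrite in_fset_set // => /set_mem[lp mp lpE _].
    by rewrite {2}lpE -!tM // starM !cmulA.
  rewrite E star_sum; apply: eq_bigr => p _.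
  by have [] := range_projection (kcomp l p.1).
rewrite -sa starM; have [_ ->] := range_projection l.
by have [_ ->] := range_projection m.
Qed.

(** Both sides vanish if [rng l] is not [v]; this case is included because [foldl_cmul_eq0] asks all
    factors to commute. *)
Lemma vertex_range_comm v l : t (idp v) ** rproj l = rproj l ** t (idp v).
Proof.
have [lv|lv] := EM (rng l = v); first by rewrite vertex_range ?range_vertex.
rewrite -[t l](vertex_mul l) starM; have [_ ->] := vertex_projection (rng l).
rewrite !cmulA -[RHS]cmulA; have [_ orth] := tv.
by rewrite !orth ?cmul0l ?cmul0r //; exact: nesym.
Qed.

Lemma gap_comm v l m : gap t v l ** gap t v m = gap t v m ** gap t v l.
Proof.
rewrite /gap !cmulBl !cmulBr !vertex_range_comm (range_comm m l).
by rewrite !opprB addrACA [RHS]addrACA; congr (_ + _); rewrite addrC.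
Qed.

Lemma star_foldl_gap v l m b e E : m \in e :: E -> rng l = v ->
  src m = rng b -> l = kcomp m b ->
  star (t l) ** foldl (fun x n => x ** gap t v n) (gap t v e) E = 0.
Proof.
move=> mE <- mb lE; apply: foldl_cmul_eq0 mE _; first exact: gap_comm.
exact: star_gap lE.
Qed.

End MinExt.

End Family.

Section CuntzKrieger.
Variables (R : realType) (A : cstarAlgType R) (k : nat) (L : kgraph k).
Variable t : L -> A.
Implicit Types (v : vertex L) (l m a b : L).

Local Notation rproj l := (t l ** star (t l)).

Lemma ck_src : ck_family t -> forall l, star (t l) ** t l = t (idp (src l)).
Proof.
move=> ck l; rewrite (ck_min ck) min_ext_self fsbig_set1 /=.
by have [vv vs] := (ck_vertex ck).1 (src l); rewrite vs vv.
Qed.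

Lemma ck_vertex_sum v (F : set L) : ck_family t -> finite_set F ->
  exhaustive v F ->
  (forall l m, F l -> F m -> min_ext l m !=set0 -> l = m) ->
  t (idp v) = \sum_(l \in F) rproj l.
Proof.
move=> ck finF exF disj; rewrite fsbig_finite //.
have FE l : (l \in enum_fset (fset_set F)) = (l \in F) by exact: in_fset_set.
have := fset_uniq (fset_set F).
case: (enum_fset _) FE => [|l E] FE uE.
  (* The enumeration cannot be empty, since some element of [F] must meet [idp v]. *)
  have [l Fl _] := exF.2 (idp v) (rng_idp v).
  by have := FE l; rewrite mem_set.
have memE m : m \in l :: E -> F m by rewrite FE => /set_mem.
have setE : [set` l :: E] = F.
  apply/seteqP; split=> m /=; first exact: memE.
  by move=> Fm; rewrite FE mem_set.
have exE : exhaustive v [set` l :: E] by rewrite setE.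
have := ck_exhaustive ck uE exE.
rewrite (foldl_gap (ck_vertex ck) (ck_comp ck) (ck_src ck)) //.
- by move/eqP; rewrite subr_eq0 => /eqP.
- exact: exE.1.
move=> m n /memE Fm /memE Fn mn; rewrite (ck_min ck).
suff -> : min_ext m n = set0 by rewrite fsbig_set0.
apply: contrapT => /eqP/set0P /(disj _ _ Fm Fn) /eqP.
by rewrite (negPf mn).
Qed.

Lemma ck_row_finite : locally_convex L -> row_finite L ->
  ck_family t -> row_finite_ck_family t.
Proof.
move=> lc fin ck; split; [exact: ck_vertex | exact: ck_comp | exact: ck_src |].
move=> v n; apply: ck_vertex_sum => //; first exact: finite_paths_le.
  exact: paths_le_exhaustive.
(* Neither path can be continued within the bound [n], so both components of a minimal extension are
   vertices and [l = m]. *)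
move=> l m [lv ln] [mv mn] [p lmp]; have [lp mp E _] := lmp.
have p1 := paths_le_min_ext ln (proj1 mn) lmp.
have p2 := paths_le_min_ext mn (proj1 ln) (min_ext_swap lmp).
by move: E; rewrite p1 (p2 : p.2 = _) !comp_idr.
Qed.

(** * From row-finite families to Cuntz-Krieger families *)

Section RowFinite.
Hypothesis fin : row_finite L.
Hypothesis rck : row_finite_ck_family t.

Let tv := rck_vertex rck.
Let tM := rck_comp rck.
Let tS := rck_src rck.

Lemma rck_sum_seq v n :
  t (idp v) = \sum_(l <- fset_set (paths_to v `&` paths_le n)) rproj l.
Proof. by rewrite (rck_sum rck v n) fsbig_finite //; exact: finite_paths_le. Qed.

Lemma rck_orthogonal v n l m : rng l = v -> rng m = v ->
  paths_le n l -> paths_le n m -> l <> m -> star (t l) ** t m = 0.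
Proof.
move=> lv mv ln mn /eqP lm; apply/(range_orthogonal tv tM tS).
have memE x : (x \in fset_set (paths_to v `&` paths_le n)) =
    (x \in paths_to v `&` paths_le n).
  by rewrite in_fset_set //; exact: finite_paths_le.
apply: (orthogonal_of_sum_projections (fset_uniq _) (vertex_projection tv v)
  _ _ (esym (rck_sum_seq v n))) => //.
- by move=> x _; exact: range_projection.
- by move=> x; rewrite memE => /set_mem[xv _]; exact: vertex_range.
- by rewrite memE mem_set.
- by rewrite memE mem_set.
Qed.

Lemma paths_le_comp n l a : src l = rng a -> degree_le (deg l) n ->
  paths_le [ffun i => (n i - deg l i)%N] a -> paths_le n (kcomp l a).
Proof.
move=> la ln [an top]; split=> i; rewrite deg_compE //.
  by have /= := an i; have /= := ln i; rewrite ffunE; lia.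
by move=> lt_i; rewrite src_comp //; apply: top; rewrite ffunE; lia.
Qed.

Lemma rck_min l m : star (t l) ** t m =
  \sum_(p \in min_ext l m) (t p.1 ** star (t p.2)).
Proof.
have [lm|lm] := EM (rng l = rng m); last first.
  rewrite (star_mul_eq0_rng tv tM lm) (_ : min_ext l m = set0) ?fsbig_set0 //.
  by apply: contrapT => /eqP/set0P/min_ext_rng.
pose n := degree_join (deg l) (deg m).
have ln : degree_le (deg l) n by move=> i; rewrite ffunE leq_maxl.
have mn : degree_le (deg m) n by move=> i; rewrite ffunE leq_maxr.
(* The paths that complete [x] to an element of [paths_le n]. *)
pose X (x : L) : set L :=
  paths_to (src x) `&` paths_le [ffun i => (n i - deg x i)%N].
have XE x a : (a \in fset_set (X x)) = (a \in X x).
  by rewrite in_fset_set //; exact: finite_paths_le.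
have expand (x : L) : t x = \sum_(a <- fset_set (X x)) t (kcomp x a) ** star (t a).
  rewrite -[LHS](mul_vertex tM) (rck_sum_seq _ [ffun i => (n i - deg x i)%N]).
  rewrite cmul_sumr; apply: eq_big_seq => a; rewrite XE => /set_mem[xa _].
  by rewrite cmulA tM.
rewrite (expand l) (expand m) star_sum cmul_suml.
under eq_bigr do rewrite cmul_sumr.
(* The term at [(a, b)] vanishes by orthogonality unless [kcomp l a = kcomp m b]. In that case the
   degree lies between the join [n] and itself, so the extension is minimal. *)
rewrite (fsum_filter
  (s := [seq (a, b) | a <- fset_set (X l), b <- fset_set (X m)])).
- rewrite [RHS]big_mkcond [RHS]big_allpairs_dep /=; apply: eq_big_seq => a.
  rewrite XE => /set_mem[la lan]; apply: eq_big_seq => b.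
  rewrite XE => /set_mem[mb mbn].
  have la' := esym la; have mb' := esym mb.
  rewrite starM starK cmulA -[t a ** _ ** _]cmulA.
  have lan' := paths_le_comp la' ln lan; have mbn' := paths_le_comp mb' mn mbn.
  case: ifPn => [/set_mem[/= _ _ E _]|].
    by rewrite -E tS src_comp // mul_vertex.
  move=> /negP nmin; rewrite (@rck_orthogonal (rng l) n) ?cmul0r ?cmul0l //.
  + exact: rng_comp.
  + by rewrite rng_comp.
  move=> E; apply: nmin; apply: mem_set; split=> //=.
  apply: degree_le_antisym; first by have [] := lan'.
  by move=> i; rewrite ffunE geq_max {2}E !deg_compE // !leq_addr.
- by apply: allpairs_uniq => [||[? ?] [? ?] _ _ /=]; rewrite ?fset_uniq.
- move=> [a b] /= [/= la mb E D]; apply: allpairs_f.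
    rewrite XE mem_set //; split=> //.
    split=> [i|i]; rewrite ffunE /n -D deg_compE // addKn.
      exact: leqnn.
    by rewrite ltnn.
  rewrite XE mem_set //; split=> //.
  split=> [i|i]; rewrite ffunE /n -D E deg_compE // addKn.
    exact: leqnn.
  by rewrite ltnn.
Qed.

Lemma rck_exhaustive v l E : exhaustive v [set` l :: E] ->
  foldl (fun x m => x ** gap t v m) (gap t v l) E = 0.
Proof.
move=> [Ev exE]; set x := foldl _ _ _.
have lv : rng l = v by apply: Ev; rewrite /= mem_head.
have [vv _] := vertex_projection tv v.
have <- : t (idp v) ** x = x.
  by apply: foldl_cmul_id; rewrite cmulBr vv (vertex_range tM).
(* This [n] dominates the degrees in the exhaustive set, so a path in [paths_le n] that meets [m]
   has [m] as a prefix. *)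
pose n := [ffun i => \max_(m <- l :: E) deg m i]%N.
rewrite (rck_sum_seq v n) cmul_suml big_seq big1 // => a.
rewrite in_fset_set; last exact: finite_paths_le.
move=> /set_mem[av an]; have [m mE ne] := exE a av.
have [p amp] : min_ext a m !=set0 by case: ne => p /min_ext_swap; exists (p.2, p.1).
have [_ mp] := amp; rewrite (paths_le_min_ext an _ amp).
  rewrite comp_idr => aE _; rewrite -cmulA.
  have aligned := row_finite_aligned fin.
  by rewrite (star_foldl_gap tv tM tS aligned rck_min mE av mp aE) cmul0r.
by move=> i; rewrite ffunE; exact: (leq_bigmax_seq (F := fun m => deg m i)).
Qed.

Lemma row_finite_ck : ck_family t.
Proof.
split=> //.
- exact: row_finite_aligned.
- by move=> l; exact: mul_star_mul.
- exact: rck_min.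
- by move=> v l E _; exact: rck_exhaustive.
Qed.

End RowFinite.

End CuntzKrieger.

(** * One-graphs *)

Section OneGraph.
Variable L : kgraph 1.
Implicit Types (v : vertex L) (l m a b e : L).

Lemma one_degreeP (n n' : {ffun 'I_1 -> nat}) : n ord0 = n' ord0 -> n = n'.
Proof. by move=> E; apply/ffunP => i; rewrite (ord1 i). Qed.

Lemma edge_deg e : @edge L e -> deg e ord0 = 1%N.
Proof. by rewrite /edge /= => ->; rewrite ffunE. Qed.

Lemma one_prefix l n : (n <= deg l ord0)%N ->
  exists a b, [/\ src a = rng b, l = kcomp a b, deg a ord0 = n &
    deg b ord0 = (deg l ord0 - n)%N].
Proof.
move=> nl; have [|a [b [ab lE da db]]] := @comp_factor _ _ l [ffun=> n].
  by move=> i; rewrite ffunE (ord1 i).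
by exists a, b; split; rewrite // ?da ?db ?ffunE.
Qed.

Lemma one_prefix_edge l : (0 < deg l ord0)%N ->
  exists e f, [/\ src e = rng f, l = kcomp e f, @edge L e &
    deg f ord0 = (deg l ord0).-1].
Proof.
move=> /one_prefix[e [f [ef lE de df]]]; exists e, f; split=> //.
  by apply: one_degreeP; rewrite de ffunE.
by rewrite df subn1.
Qed.

(** Degrees are totally ordered in rank one, and unique factorisation makes the shorter path a
    prefix. *)
Lemma one_min_ext_prefix l m : (deg l ord0 <= deg m ord0)%N ->
  min_ext l m !=set0 -> exists2 b, src l = rng b & m = kcomp l b.
Proof.
move=> /one_prefix[a [b [ab mE da _]]] [[c d] [/= lc md E _]].
have bd : src b = rng d by rewrite -md mE src_comp.
have [||la _] := @comp_inj _ _ l c a (kcomp b d) lc _ (one_degreeP (esym da)).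
- by rewrite rng_comp.
- by rewrite compA // -mE.
by exists b; rewrite la.
Qed.

Lemma one_finitely_aligned : finitely_aligned L.
Proof.
suff fin l m : (deg l ord0 <= deg m ord0)%N -> finite_set (min_ext l m).
  move=> l m; have [/fin//|/ltnW/fin ml] := leqP (deg l ord0) (deg m ord0).
  by rewrite min_ext_sym; exact: finite_image.
move=> lm; have [->//|/eqP/set0P/(one_min_ext_prefix lm)[b lb ->]] :=
  EM (min_ext l m = set0).
by rewrite min_ext_prefix.
Qed.

Lemma edges_exhaustive v : paths_to v `&` @edge L !=set0 ->
  exhaustive v (paths_to v `&` @edge L).
Proof.
move=> [e0 [e0v e0e]]; split=> [l []//|m /= mv].
have [m0|m_gt0] := posnP (deg m ord0).
  (* A path of degree 0 is [idp v], which every edge into [v] extends. *)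
  exists e0 => //; have [mE _] : m = idp (rng m) /\ src m = rng m.
    by apply: deg0_idp; apply: one_degreeP; rewrite m0 ffunE.
  apply: (@min_ext_common _ _ _ _ (idp (src e0)) e0); rewrite ?rng_idp //.
    by rewrite mE src_idp mv -e0v.
  by rewrite comp_idr mE mv -e0v comp_idl.
have [e [f [ef mE ee _]]] := one_prefix_edge m_gt0.
exists e; first by split=> //=; rewrite -mv mE rng_comp.
apply: (@min_ext_common _ _ _ _ f (idp (src m))) => //; first by rewrite rng_idp.
by rewrite comp_idr.
Qed.

End OneGraph.

Section GraphFamily.
Variables (R : realType) (A : cstarAlgType R) (L : kgraph 1) (t : L -> A).
Implicit Types (v : vertex L) (l m a b e f : L).

Local Notation rproj l := (t l ** star (t l)).

Lemma ck_graph : ck_family t -> graph_ck_family t.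
Proof.
move=> ck; have tv := ck_vertex ck; have tM := ck_comp ck; have tS := ck_src ck.
have disj e f : @edge L e -> @edge L f -> min_ext e f !=set0 -> e = f.
  by move=> ee ef; apply: min_ext_eq_deg; apply: etrans ee (esym ef).
split=> //.
- move=> e f ee ef nef; apply/(range_orthogonal tv tM tS); rewrite (ck_min ck).
  rewrite (_ : min_ext e f = set0) ?fsbig_set0 //.
  by apply: contrapT => /eqP/set0P/(disj _ _ ee ef).
(* The gap is a projection, hence its own witness of positivity. *)
- move=> e ee; exists (gap t (rng e) e); have [gg gs] : projection (gap t (rng e) e).
    apply: projectionB; [exact: vertex_projection|exact: range_projection|].
    exact: vertex_range.
  by rewrite gs gg.
move=> v ne fin; apply: ck_vertex_sum => //; first exact: edges_exhaustive.
by move=> l m [_ le] [_ me]; exact: disj.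
Qed.

(** * From graph families to Cuntz-Krieger families *)

Section GraphToCK.
Hypothesis gck : graph_ck_family t.

Let tv := gck_vertex gck.
Let tM := gck_comp gck.

Lemma gck_src_path l : star (t l) ** t l = t (idp (src l)).
Proof.
move sE: (deg l ord0) => s; elim: s l sE => [|s IH] l sE.
  have [-> _] := @deg0_idp _ _ l (one_degreeP (etrans sE (esym (ffunE _ _)))).
  by rewrite src_idp; have [vv ->] := vertex_projection tv (rng l).
have [|e [f [ef lE ee df]]] := @one_prefix_edge _ l; first by rewrite sE.
rewrite lE -tM // starM cmulA -[_ ** t e]cmulA (gck_src gck) // ef -cmulA.
by rewrite (vertex_mul tM) IH ?src_comp // df sE.
Qed.

Let tS := gck_src_path.

(** Compare first edges: distinct ones have orthogonal ranges, equal ones cancel and leave shorter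
    paths. *)
Lemma gck_orthogonal l m : deg l = deg m -> l <> m -> star (t l) ** t m = 0.
Proof.
move sE: (deg l ord0) => s; elim: s l m sE => [|s IH] l m sE dlm lm.
  apply: (star_mul_eq0_rng tv tM) => rlm; apply: lm.
  have l0 : deg l = 0 by apply: one_degreeP; rewrite sE ffunE.
  have [-> _] := deg0_idp l0; have [-> _] := deg0_idp (etrans (esym dlm) l0).
  by rewrite rlm.
have [|e [l' [el lE ee dl']]] := @one_prefix_edge _ l; first by rewrite sE.
have [|f [m' [fm mE fe dm']]] := @one_prefix_edge _ m; first by rewrite -dlm sE.
rewrite lE mE -!tM // starM cmulA -[_ ** t f]cmulA.
have [ef|ef] := EM (e = f); last first.
  have -> : star (t e) ** t f = 0.
    by apply/(range_orthogonal tv tM tS); exact: gck_orth.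
  by rewrite cmul0r cmul0l.
rewrite -ef tS el -cmulA -[X in t (idp X)]el ef fm (vertex_mul tM).
apply: IH; first by rewrite dl' sE.
  by apply: one_degreeP; rewrite dl' dm' dlm.
by move=> lm'; apply: lm; rewrite lE mE ef lm'.
Qed.

Lemma gck_min l m : star (t l) ** t m =
  \sum_(p \in min_ext l m) (t p.1 ** star (t p.2)).
Proof.
have one_side x y : (deg x ord0 <= deg y ord0)%N -> star (t x) ** t y =
    \sum_(p \in min_ext x y) (t p.1 ** star (t p.2)).
  (* Cut [y] at the degree of [x]: if the initial piece is [x], there is exactly one minimal
     extension; otherwise both sides vanish. *)
  move=> xy; have [a [b [ab yE da _]]] := one_prefix xy.
  have [ax|ax] := EM (x = a).
    rewrite yE ax min_ext_prefix // fsbig_set1 -tM // cmulA tS ab.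
    rewrite (vertex_mul tM) /=; have [_ ->] := vertex_projection tv (src b).
    by rewrite (mul_vertex tM).
  rewrite (_ : min_ext x y = set0) ?fsbig_set0.
    by rewrite yE -tM // cmulA gck_orthogonal ?cmul0l //; apply: one_degreeP.
  apply: contrapT => /eqP/set0P/(one_min_ext_prefix xy)[b' xb' yE'].
  apply: ax; have [] // := comp_inj xb' ab (one_degreeP (esym da)).
  by rewrite -yE'.
have [/one_side//|/ltnW/one_side ml] := leqP (deg l ord0) (deg m ord0).
have -> : star (t l) ** t m = star (star (t m) ** t l) by rewrite starM starK.
rewrite ml.
have fin (x y : L) : finite_set (min_ext x y) by exact: one_finitely_aligned.
rewrite !fsbig_finite // star_sum [min_ext m l]min_ext_sym fset_set_image //.
rewrite big_imfset /=.
  by apply: eq_bigr => p _; rewrite starM starK.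
by move=> [a b] [c d] _ _ /= [-> ->].
Qed.

Lemma gck_exhaustive v l E : exhaustive v [set` l :: E] ->
  foldl (fun x m => x ** gap t v m) (gap t v l) E = 0.
Proof.
move=> [Ev exE]; set x := foldl _ _ _.
have lv : rng l = v by apply: Ev; rewrite /= mem_head.
have [vv _] := vertex_projection tv v.
have vx : t (idp v) ** x = x.
  by apply: foldl_cmul_id; rewrite cmulBr vv (vertex_range tM).
pose N := (\max_(m <- l :: E) deg m ord0)%N.
have leN m : m \in l :: E -> (deg m ord0 <= N)%N.
  by move=> mE; exact: (leq_bigmax_seq (F := fun m : L => deg m ord0)).
have prefix_kill a m b : rng a = v -> m \in l :: E -> src m = rng b ->
    a = kcomp m b -> star (t a) ** x = 0.
  move=> av mE mb aE.
  exact: (star_foldl_gap tv tM tS (@one_finitely_aligned L) gck_min mE av mb aE).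
(* Induction on [N - d(a)]: if no element of the exhaustive set is a prefix of
   a, then every edge into [src a] is met by a longer element, so these edges
   are finite in number and [t_(src a)] is the sum of their range projections. *)
suff kill s a : rng a = v -> (N <= deg a ord0 + s)%N -> star (t a) ** x = 0.
  have := kill N (idp v) (rng_idp v) (leq_addl _ _).
  by have [_ ->] := vertex_projection tv v; rewrite vx.
elim: s a => [|s IH] a av.
  rewrite addn0 => Na; have [m mE ne] := exE a av.
  have [b mb aE] := one_min_ext_prefix (leq_trans (leN m mE) Na) ne.
  exact: prefix_kill mE mb aE.
move=> Na; have [[m mE [b mb aE]]|nprefix] :=
    EM (exists2 m, m \in l :: E & exists2 b, src m = rng b & a = kcomp m b).
  exact: prefix_kill mE mb aE.
(* A common extension of [m] and [kcomp a c] also extends [a]; were [m] no longer than [a], it would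
   be a prefix of [a]. *)
have longer c : src a = rng c -> exists2 m, m \in l :: E &
    (deg a ord0 < deg m ord0)%N /\ min_ext m (kcomp a c) !=set0.
  move=> ac; have [|m mE ne] := exE (kcomp a c).
    by rewrite /paths_to /= rng_comp.
  exists m => //; split=> //; rewrite ltnNge; apply/negP => ma.
  apply: nprefix; exists m => //.
  apply: (one_min_ext_prefix ma); case: ne => -[p q] [/= mp acq E' _].
  have cq : src c = rng q by rewrite -acq src_comp.
  apply: (@min_ext_common _ _ _ _ p (kcomp c q)); rewrite ?rng_comp //.
  by rewrite compA.
have step e : src a = rng e -> @edge L e -> exists2 m, m \in l :: E &
    exists2 b, src (kcomp a e) = rng b & m = kcomp (kcomp a e) b.
  move=> ae ee; have [m mE [am ne]] := longer e ae; exists m => //.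
  apply: one_min_ext_prefix; first by rewrite deg_compE // (edge_deg ee) addn1.
  by case: ne => p /min_ext_swap pE; exists (p.2, p.1).
pose W := paths_to (src a) `&` @edge L.
have W0 : W !=set0.
  have [|m mE [am ne]] := longer (idp (src a)); first by rewrite rng_idp.
  rewrite comp_idr in ne.
  have [|b ab mE'] := @one_min_ext_prefix _ a m (ltnW am).
    by case: ne => p /min_ext_swap pE; exists (p.2, p.1).
  have [|e [er ee]] := @deg_generator_prefix _ _ b ord0.
    by move: am; rewrite mE' deg_compE //; lia.
  by exists e; split=> //=; rewrite ab.
have finW : finite_set W.
  apply: (@sub_finite_set _ _ (\bigcup_(m in [set` l :: E])
    [set e | W e /\ exists2 b, src (kcomp a e) = rng b & m = kcomp (kcomp a e) b])).
    move=> e [er ee]; have [m mE pm] := step e (esym er) ee.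
    by exists m => //; split=> //; split.
  apply: bigcup_finite => [|m _]; first exact: finite_seq.
  (* Each [m] accounts for at most one edge: cancelling [a] in two factorisations of [m] leaves a
     single path with both edges as first edge. *)
  set S := [set e | _]; have [->//|/eqP/set0P[e Se]] := EM (S = set0).
  apply: (@sub_finite_set _ _ [set e]) => // f Sf; move: Se Sf.
  move=> [[er ee] [b aeb mE]] [[fr fe] [c afc mE']].
  have ae := esym er; have af := esym fr.
  have eb : src e = rng b by rewrite -aeb src_comp.
  have fc : src f = rng c by rewrite -afc src_comp.
  move: mE'; rewrite mE -!compA // => /comp_injl.
  rewrite !rng_comp // => /(_ ae af)/comp_inj[] //.
  by apply: etrans ee (esym fe).
(* Inserting the sum for [src a] to the left of [star (t a)] produces the terms
   [t e ** star (t (kcomp a e))], to which the induction hypothesis applies. *)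
rewrite -(vertex_star tv tM) (gck_sum gck W0 finW) fsbig_finite //.
rewrite -cmulA cmul_suml big_seq big1 // => e.
rewrite in_fset_set // => /set_mem[er ee]; have ae := esym er.
rewrite -cmulA [star (t e) ** _]cmulA -starM tM // IH ?cmul0r ?rng_comp //.
by rewrite deg_compE // (edge_deg ee) addn1 addSnnS.
Qed.

Lemma graph_ck : ck_family t.
Proof.
split=> //.
- exact: one_finitely_aligned.
- by move=> l; exact: mul_star_mul.
- exact: gck_min.
- by move=> v l E _; exact: gck_exhaustive.
Qed.

End GraphToCK.

End GraphFamily.

Theorem propositionB1 (R : realType) (A : cstarAlgType R) :
  (forall (L : kgraph 1) (t : L -> A),
     (forall l, partial_isometry (t l)) ->
     (ck_family t <-> graph_ck_family t)) /\
  (forall (k : nat) (L : kgraph k) (t : L -> A),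
     locally_convex L -> row_finite L ->
     (forall l, partial_isometry (t l)) ->
     (ck_family t <-> row_finite_ck_family t)).
Proof.
split=> [L t _|k L t lc fin _].
  by split; [exact: ck_graph | exact: graph_ck].
by split; [exact: ck_row_finite | exact: row_finite_ck].
Qed.
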